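(* Let $X_1$ and $X_2$ be quandles, let $X:=X_1\times X_2$ be their Cartesian product with component-wise multiplication, and fix elements $y_0\in X_1$ and $z_0\in X_2$. Define maps $P_1,P_2:X\to X$ by $$P_1\big((x',x'')\big)=(x',z_0),\qquad P_2\big((x',x'')\big)=(y_0,x''),\qquad x'\in X_1,\ x''\in X_2.$$ Then each of the operators $P_1$ and $P_2$ is an averaging operator on $X$.
   Context: A quandle is a non-empty set $Q$ with a binary operation $*$ such that (Q1) $x*x=x$ for all $x\in Q$; (Q2) for all $x,y\in Q$ there is a unique $z\in Q$ with $x=z*y$; (Q3) $(x*y)*z=(x*z)*(y*z)$ for all $x,y,z\in Q$. An averaging operator (meaning: right averaging operator) on $(X,* )$ is a map $B:X\to X$ such that $B(x)*B(y)=B(x*B(y))$ for all $x,y\in X$. *)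

(* Defs.v *)
Set Implicit Arguments.
Unset Strict Implicit.

Record quandle : Type := Quandle {
  qcarrier :> Type;
  qop : qcarrier -> qcarrier -> qcarrier;
  q_nonempty : inhabited qcarrier;
  q_idem : forall x, qop x x = x;
  q_rdiv : forall x y, exists! z, x = qop z y;
  q_distr : forall x y z, qop (qop x y) z = qop (qop x z) (qop y z)
}.

Declare Scope quandle_scope.
Delimit Scope quandle_scope with Q.
Notation "x * y" := (qop x y) : quandle_scope.

Section ProductQuandle.
Variables X1 X2 : quandle.

Definition prod_op (x y : X1 * X2) : X1 * X2 :=
  ((fst x * fst y)%Q, (snd x * snd y)%Q).

Lemma prod_nonempty : inhabited (X1 * X2).
Proof.
destruct (q_nonempty X1) as [a], (q_nonempty X2) as [b].
exact (inhabits (a, b)).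
Qed.

Lemma prod_idem x : prod_op x x = x.
Proof. destruct x as [a b]; unfold prod_op; cbn; now rewrite !q_idem. Qed.

Lemma prod_rdiv x y : exists! z, x = prod_op z y.
Proof.
destruct x as [a b], y as [c d].
destruct (q_rdiv a c) as [u [Hu Uu]], (q_rdiv b d) as [v [Hv Uv]].
exists (u, v); split.
- unfold prod_op; cbn; now rewrite <- Hu, <- Hv.
- intros [u' v'] H; unfold prod_op in H; cbn in H; injection H as H1 H2.
  now rewrite (Uu _ H1), (Uv _ H2).
Qed.

Lemma prod_distr x y z :
  prod_op (prod_op x y) z = prod_op (prod_op x z) (prod_op y z).
Proof. unfold prod_op; cbn; f_equal; apply q_distr. Qed.

Definition prod_quandle : quandle :=
  Quandle prod_nonempty prod_idem prod_rdiv prod_distr.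

End ProductQuandle.

(* "Averaging" always means right averaging; the definition only needs a set
   with a binary operation. *)
Definition averaging_operator (T : Type) (op : T -> T -> T) (B : T -> T) : Prop :=
  forall x y : T, op (B x) (B y) = B (op x (B y)).

Definition P1 (X1 X2 : quandle) (z0 : X2)
  (x : prod_quandle X1 X2) : prod_quandle X1 X2 := (fst x, z0).

Definition P2 (X1 X2 : quandle) (y0 : X1)
  (x : prod_quandle X1 X2) : prod_quandle X1 X2 := (y0, snd x).

(* Main.v *)
Require Import Defs.

Theorem proposition5p3 (X1 X2 : quandle) (y0 : X1) (z0 : X2) :
  averaging_operator (@qop (prod_quandle X1 X2)) (@P1 X1 X2 z0) /\
  averaging_operator (@qop (prod_quandle X1 X2)) (@P2 X1 X2 y0).
Proof.
  (* On the kept coordinate both sides are literally the same product; on the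
     constant coordinate they differ only by idempotency of [z0] or [y0]. *)
  split; intros x y; unfold P1, P2; cbn; unfold prod_op; cbn;
    now rewrite q_idem.
Qed.
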